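(* Let $X\in\mathbb R^{d\times n}$ and $1\le K\le d$. The non-greedy algorithm (NGA) $U^{k+1}=\operatorname{PD}\left(X\operatorname{sgn}(X^\top U^k)\right)$ is a special instance of the alternating maximization method applied to $$\max_{U,S}\ \langle X^\top U,S\rangle\quad\text{s.t. } U\in\mathrm{St}(d,K),\ \|S\|_\infty\le1;$$ that is, for every sequence generated by NGA, setting $S^k=\operatorname{sgn}(X^\top U^k)$ one has for all $k$ $$S^k\in\arg\max_{\|S\|_\infty\le1}\langle X^\top U^k,S\rangle,\qquad U^{k+1}\in\arg\max_{U\in\mathrm{St}(d,K)}\langle XS^k,U\rangle.$$
   Context: $\mathrm{St}(m,n)=\{U\in\mathbb R^{m\times n}: U^\top U=I\}$, $m\ge n$. $\|\cdot\|_\infty$ is the largest absolute value of the entries, $\langle\cdot,\cdot\rangle$ the Frobenius inner product. $\operatorname{sgn}(x)=x/|x|$ if $x\ne0$, $\operatorname{sgn}(0)=0$, applied entrywise. Polar decomposition: for $C\in\mathbb R^{m\times n}$, $m\ge n$, a polar decomposition is $C=UH$ with $U\in\mathrm{St}(m,n)$ and $H$ symmetric positive semidefinite; $U=\operatorname{PD}(C)$ means that $U$ is such a factor. *)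

(* Defs.v *)
From HB Require Import structures.
From mathcomp Require Import all_boot all_order all_algebra.
From mathcomp Require Import all_classical all_reals all_analysis.

Set Implicit Arguments.
Unset Strict Implicit.
Unset Printing Implicit Defensive.

Import Order.TTheory GRing.Theory Num.Theory.

Local Open Scope classical_set_scope.
Local Open Scope ring_scope.

Definition argmax (T : Type) (R : realType) (A : set T) (f : T -> R) : set T :=
  [set x | A x /\ forall y, A y -> f y <= f x].

(* Alternating maximization of [f] over [A] x [B]: the [x]-iterate is given,
   [y] is updated first.  The starting point [x 0] is arbitrary; it is not
   required to lie in [A]. *)
Definition alternating_maximization (T1 T2 : Type) (R : realType)
    (A : set T1) (B : set T2) (f : T1 -> T2 -> R)
    (x : nat -> T1) (y : nat -> T2) : Prop :=
  forall k : nat,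
    argmax B (f (x k)) (y k) /\ argmax A (f ^~ (y k)) (x k.+1).

Definition frobenius (R : realType) (m n : nat) (A B : 'M[R]_(m, n)) : R :=
  \sum_(i < m) \sum_(j < n) A i j * B i j.

Definition stiefel (R : realType) (m n : nat) : set 'M[R]_(m, n) :=
  [set U | U^T *m U = 1%:M].
Arguments stiefel {R} m n.

(* [mx_norm] is the largest absolute value of the entries. *)
Definition unit_ball_max (R : realType) (m n : nat) : set 'M[R]_(m, n) :=
  [set S | mx_norm S <= 1].
Arguments unit_ball_max {R} m n.

Definition sgnmx (R : realType) (m n : nat) (A : 'M[R]_(m, n)) : 'M[R]_(m, n) :=
  map_mx Num.sg A.

Definition sym_psd (R : realType) (n : nat) (H : 'M[R]_n) : Prop :=
  H^T = H /\ forall v : 'cV[R]_n, 0 <= (v^T *m H *m v) 0 0.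

Definition polar_decomposition (R : realType) (m n : nat)
    (C U : 'M[R]_(m, n)) (H : 'M[R]_n) : Prop :=
  [/\ stiefel m n U, sym_psd H & C = U *m H].

(* [is_PD C U] renders "U = PD(C)"; the factor U need not be unique. *)
Definition is_PD (R : realType) (m n : nat) (C U : 'M[R]_(m, n)) : Prop :=
  exists H : 'M[R]_n, polar_decomposition C U H.

(* As in [alternating_maximization], the starting point [U 0] is arbitrary. *)
Definition NGA (R : realType) (d n K : nat) (X : 'M[R]_(d, n))
    (U : nat -> 'M[R]_(d, K)) : Prop :=
  forall k : nat, is_PD (X *m sgnmx (X^T *m U k)) (U k.+1).

(* Main.v *)
Require Import Defs.
From HB Require Import structures.
From mathcomp Require Import all_boot all_order all_algebra.
From mathcomp Require Import all_classical all_reals all_analysis.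
From mathcomp Require Import lra.

Import Order.TTheory GRing.Theory Num.Theory.

Local Open Scope classical_set_scope.
Local Open Scope ring_scope.

(** The S-step separates over the entries.  For the U-step, let [C = U *m H] be
    a polar decomposition and [V] another point of the Stiefel manifold.  Since
    [U] and [V] both have orthonormal columns, the nonnegative number
    [\tr ((V - U) *m H *m (V - U)^T)] equals [2 (\tr H - <C, V>)], and
    [\tr H = <C, U>]; in particular no spectral decomposition of [H] is needed. *)

Lemma frobeniusE (R : realType) (m n : nat) (A B : 'M[R]_(m, n)) :
  frobenius A B = \tr (A^T *m B).
Proof.
rewrite /frobenius /mxtrace exchange_big; apply: eq_bigr => j _.
by rewrite mxE; apply: eq_bigr => i _; rewrite mxE.
Qed.

(** Both sides are traces of transposed products. For fixed [T] this turns the joint objective into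
    the linear form maximized in the U-step. *)
Lemma frobenius_mulmx_tr (R : realType) (d n K : nat) (X : 'M[R]_(d, n))
    (V : 'M[R]_(d, K)) (T : 'M[R]_(n, K)) :
  frobenius (X^T *m V) T = frobenius (X *m T) V.
Proof.
by rewrite !frobeniusE -mxtrace_tr !trmx_mul !trmxK mulmxA.
Qed.

Lemma unit_ball_maxP (R : realType) (m n : nat) (S : 'M[R]_(m, n)) :
  unit_ball_max m n S <-> forall i j, `|S i j| <= 1.
Proof.
rewrite /unit_ball_max /= mx_normrE; split.
  by move=> /bigmax_leP[_ S1] i j; exact: (S1 (i, j)).
by move=> S1; apply/bigmax_leP; split=> // ij _; exact: S1.
Qed.

Lemma argmax_sgnmx (R : realType) (m n : nat) (A : 'M[R]_(m, n)) :
  argmax (unit_ball_max m n) (frobenius A) (sgnmx A).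
Proof.
split.
  by apply/unit_ball_maxP => i j; rewrite mxE normr_sg; case: (_ == _).
move=> T /unit_ball_maxP T1; apply: ler_sum => i _; apply: ler_sum => j _.
(* The right-hand side is [|A i j|], which bounds each term since [|T i j| <= 1]. *)
rewrite mxE [X in _ <= X]mulrC -normrEsg (le_trans (ler_norm _))//.
by rewrite normrM ler_piMr.
Qed.

(** Each diagonal entry is the quadratic form of [H] evaluated at a row of [D]. *)
Lemma mxtrace_psd_ge0 (R : realType) (m n : nat) (H : 'M[R]_n)
    (D : 'M[R]_(m, n)) : sym_psd H -> 0 <= \tr (D *m H *m D^T).
Proof.
move=> [_ H_ge0]; apply: sumr_ge0 => i _.
have := H_ge0 (row i D)^T; rewrite trmxK -row_mul.
suff -> : (row i (D *m H) *m (row i D)^T) 0 0 = (D *m H *m D^T) i i by [].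
by rewrite mxE [RHS]mxE; apply: eq_bigr => j _; rewrite !mxE.
Qed.

Lemma argmax_PD (R : realType) (m n : nat) (C U : 'M[R]_(m, n)) :
  is_PD C U -> argmax (stiefel m n) (frobenius C) U.
Proof.
move=> [H [stU psdH ->]]; split=> // V stV.
have HT : H^T = H by case: psdH.
have trW W : stiefel m n W -> \tr (W *m H *m W^T) = \tr H.
  by move=> stW; rewrite mxtrace_mulC mulmxA stW mul1mx.
have frobE W : frobenius (U *m H) W = \tr (W *m H *m U^T).
  by rewrite frobeniusE trmx_mul HT mxtrace_mulC mulmxA.
(* Symmetry of [H] makes the two cross terms of the expansion below equal. *)
have frobEt W : frobenius (U *m H) W = \tr (U *m H *m W^T).
  by rewrite frobE -mxtrace_tr !trmx_mul trmxK HT mulmxA.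
have := @mxtrace_psd_ge0 _ _ _ _ (V - U) psdH.
(* Of the four traces, the two pure ones are [\tr H] and the two cross ones are
   [frobenius (U *m H) V]. *)
rewrite linearB /= !mulmxBl !mulmxBr !linearB /=.
rewrite (trW _ stU) (trW _ stV) -frobE -frobEt [frobenius _ U]frobE (trW _ stU).
by lra.
Qed.

Theorem proposition3p2 (R : realType) (d n K : nat) (X : 'M[R]_(d, n))
    (hK1 : (1 <= K)%N) (hKd : (K <= d)%N)
    (U : nat -> 'M[R]_(d, K)) (hU : NGA X U) :
  let S : nat -> 'M[R]_(n, K) := fun k => sgnmx (X^T *m U k) in
  alternating_maximization (stiefel d K) (unit_ball_max n K)
    (fun V T => frobenius (X^T *m V) T) U S /\
  forall k : nat,
    argmax (unit_ball_max n K) (fun T => frobenius (X^T *m U k) T) (S k) /\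
    argmax (stiefel d K) (fun V => frobenius (X *m S k) V) (U k.+1).
Proof.
move=> S.
have steps k : argmax (unit_ball_max n K) (frobenius (X^T *m U k)) (S k) /\
    argmax (stiefel d K) (frobenius (X *m S k)) (U k.+1).
  by split; [exact: argmax_sgnmx | exact/argmax_PD/hU].
split=> // k; have [maxS maxU] := steps k; split=> //.
by under [X in argmax _ X]eq_fun => V do rewrite frobenius_mulmx_tr.
Qed.
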